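(* Let $k$ be a positive integer and let $G$ be a connected $k$-regular graph of order $n$. \begin{enumerate} \item If $k$ is odd, then $G$ admits a $1$-sum $\{-1,0,1\}$-flow. \item If $k\equiv2\pmod 4$ and $n$ is even, then $G$ admits a $1$-sum $\{-1,0,1\}$-flow. \end{enumerate}
   Context: For a graph $G=(V,E)$ and $L\subseteq\mathbb{R}$, a $1$-sum $L$-flow is a function $\omega:E\to L$ such that $\sum_{e\ni v}\omega(e)=1$ for every vertex $v$. *)

(* Defs.v *)
From mathcomp Require Import all_boot all_order all_algebra.
From mathcomp Require Import classical_sets reals.

Set Implicit Arguments.
Unset Strict Implicit.
Unset Printing Implicit Defensive.

Local Open Scope ring_scope.

Record simple_graph (V : finType) := SimpleGraph {
  adj :> rel V;
  adj_sym : symmetric adj;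
  adj_irrefl : irreflexive adj }.

Definition regular (V : finType) (G : simple_graph V) (k : nat) : Prop :=
  forall v : V, #|[set u | G v u]%SET| = k.

(* The graph without vertices is not considered connected. *)
Definition connected_graph (V : finType) (G : simple_graph V) : Prop :=
  (0 < #|V|)%N /\ forall u v : V, connect G u v.

Definition edge_set (V : finType) (G : simple_graph V) : {set {set V}} :=
  [set [set p.1; p.2] | p : V * V & G p.1 p.2]%SET.

Definition edge (V : finType) (G : simple_graph V) : finType :=
  {e : {set V} | e \in edge_set G}.

Definition one_sum_flow (R : realType) (V : finType) (G : simple_graph V)
    (L : set R) (w : edge G -> R) : Prop :=
  (forall e : edge G, L (w e)) /\
  (forall v : V, \sum_(e : edge G | v \in val e) w e = 1).

Definition admits_one_sum_flow (R : realType) (V : finType)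
    (G : simple_graph V) (L : set R) : Prop :=
  exists w : edge G -> R, one_sum_flow L w.

(* Main.v *)
Require Import Defs.
From mathcomp Require Import classical_sets reals.
From mathcomp Require Import all_boot all_order all_fingroup all_algebra zify.

(* Adding 1 everywhere, a flow is a {0,1,2}-weighting of the edges with all
   vertex sums k + 1.  If k is odd, view each edge as two opposite arcs: by
   Hall's theorem the resulting k-regular bipartite relation on V contains a
   subrelation d with all in- and out-degrees (k + 1) / 2, and
   [d u v] + [d v u] is such a weighting; connectedness plays no role.
   If k = 2 mod 4 and n is even, then G has an Eulerian circuit of even length
   nk / 2; the edges at even positions form a (k / 2)-regular factor, to which
   the odd case applies, and the flow is extended by 0.

   The Eulerian circuit is a permutation of the darts: pairing the darts at
   each vertex by an involution t orients the edges so that in- and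
   out-degrees agree; among the permutations sending every positively oriented
   dart to one that starts where it ends, one with the fewest cycles has a
   single positive cycle, since two cycles through a common vertex can be
   merged by a transposition. *)

Set Implicit Arguments.
Unset Strict Implicit.
Unset Printing Implicit Defensive.

Import GRing.Theory.

(** * Hall's marriage theorem *)

Definition neighbors (T : finType) (e : rel T) (S : {set T}) : {set T} :=
  [set y | [exists x in S, e x y]].

Lemma neighborsP (T : finType) (e : rel T) (S : {set T}) y :
  reflect (exists2 x, x \in S & e x y) (y \in neighbors e S).
Proof. by rewrite inE; exact: exists_inP. Qed.

(** Induction on the size of [A]. If no nonempty proper subset is tight, any [x] in [A] can be
    matched first, to any neighbor [y]. If [S] is tight, [S] and [A :\: S] are matched separately,
    the latter outside the neighbors of [S]. *)
Lemma hall (T : finType) (e : rel T) (A : {set T}) :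
  (forall S : {set T}, S \subset A -> #|S| <= #|neighbors e S|) ->
  exists f : T -> T, {in A &, injective f} /\ {in A, forall x, e x (f x)}.
Proof.
have [n] := ubnP #|A|; elim: n => // n IHn in e A *; rewrite ltnS => leAn hallA.
have [->|[x Ax]] := set_0Vmem A; first by exists id; split=> // x; rewrite inE.
case: (boolP [exists S : {set T},
  [&& S \subset A, S != set0, S != A & #|neighbors e S| <= #|S|]]); last first.
  move=> /existsPn tightN.
  have [y]: exists y, y \in neighbors e [set x].
    by apply/card_gt0P; rewrite -(cards1 x); apply: hallA; rewrite sub1set.
  case/neighborsP=> _ /set1P-> exy.
  have ltA : #|A :\ x| < n by move: (cardsD1 x A) leAn; rewrite Ax; lia.
  have [|f [injf ef]] := IHn [rel a b | e a b && (b != y)] _ ltA.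
    move=> S subS; have [->|S_n0] := eqVneq S set0; first by rewrite cards0.
    have [SA xS] := subsetD1P subS.
    have SneA : S != A by apply: contraNneq xS => ->.
    have := tightN S; rewrite SA S_n0 SneA /= -ltnNge => ltS.
    (* Without tight sets, [S] has a spare neighbor, which pays for the loss of [y]. *)
    apply: (@leq_trans #|neighbors e S :\ y|).
      by move: (cardsD1 y (neighbors e S)) (leq_b1 (y \in neighbors e S)); lia.
    apply/subset_leq_card/subsetP=> b; rewrite in_setD1 => /andP[by_ /neighborsP[a Sa eab]].
    by apply/neighborsP; exists a => //=; rewrite eab.
  exists (fun a => if a == x then y else f a); split=> [a b aA bA|a aA].
    have [->|ax] := eqVneq a x; have [->|bx] := eqVneq b x => //.
    - move=> yf; have /andP[_] : e b (f b) && (f b != y) by apply: ef; rewrite !inE bx.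
      by rewrite -yf eqxx.
    - move=> yf; have /andP[_] : e a (f a) && (f a != y) by apply: ef; rewrite !inE ax.
      by rewrite yf eqxx.
    by apply: injf; rewrite !inE ?ax ?bx.
  have [->|ax] // := eqVneq a x.
  by have /andP[] : e a (f a) && (f a != y) by apply: ef; rewrite !inE ax.
case/existsP=> S /and4P[SA S_n0 SneA tightS].
have ltSA : #|S| < #|A| by apply: proper_card; rewrite properEneq SneA.
have [|f [injf ef]] := IHn e S (leq_trans ltSA leAn).
  by move=> S' /subset_trans/(_ SA)/hallA.
have ltD : #|A :\: S| < n.
  by rewrite cardsDS //; move: S_n0; rewrite -card_gt0; lia.
have [|g [injg eg]] := IHn [rel a b | e a b && (b \notin neighbors e S)] _ ltD.
  (* Subtracting the tightness of [S] from Hall's condition for [S :|: S'] leaves the condition for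
     [S']. *)
  move=> S' /subsetDP[S'A disS]; rewrite -(leq_add2l #|S|).
  have <- : #|S :|: S'| = #|S| + #|S'|.
    by rewrite cardsU setIC (disjoint_setI0 disS) cards0 subn0.
  apply: (leq_trans (hallA _ _)); first by rewrite subUset SA.
  apply: leq_trans (leq_add tightS (leqnn _)).
  apply: leq_trans (leq_card_setU _ _); apply/subset_leq_card/subsetP=> b.
  case/neighborsP=> a; rewrite !in_setU => Sa eab.
  have [//|bS /=] := boolP (b \in neighbors e S).
  case/orP: Sa => Sa; first by case/neighborsP: bS; exists a.
  by apply/neighborsP; exists a => //=; rewrite eab.
have eg' a : a \in A -> a \notin S -> e a (g a) && (g a \notin neighbors e S).
  by move=> aA aS; apply: eg; rewrite inE aS.
exists (fun a => if a \in S then f a else g a); split=> [a b aA bA|a aA].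
  case: ifPn => aS; case: ifPn => bS.
  - exact: injf.
  - move=> fg; case/andP: (eg' _ bA bS) => _ /neighborsP[].
    by exists a; rewrite // -fg ef.
  - move=> fg; case/andP: (eg' _ aA aS) => _ /neighborsP[].
    by exists b; rewrite // fg ef.
  by apply: injg; rewrite inE ?aS ?bS.
by case: ifPn => aS; [exact: ef | case/andP: (eg' _ aA aS)].
Qed.

(** * Factors of regular bipartite relations *)

Definition biregular (T : finType) (e : rel T) (m : nat) : Prop :=
  (forall x, #|[set y | e x y]| = m) /\ (forall y, #|[set x | e x y]| = m).

(** Hall's condition by double counting: [m * #|S|] arcs leave [S], and at most [m] of them enter
    each neighbor. *)
Lemma biregular_perfect_matching (T : finType) (e : rel T) m :
  0 < m -> biregular e m -> exists s : {perm T}, forall x, e x (s x).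
Proof.
move=> m_gt0 [outm inm].
suff /hall[f [injf ef]] : forall S : {set T}, S \subset setT -> #|S| <= #|neighbors e S|.
  have injf' : injective f by move=> x y; apply: injf; rewrite inE.
  by exists (perm injf') => x; rewrite permE; apply: ef; rewrite inE.
move=> S _.
rewrite -(leq_pmul2r m_gt0) -!sum_nat_const.
have -> : \sum_(x in S) m = \sum_y \sum_(x in S) e x y.
  by rewrite exchange_big; apply: eq_bigr => x _; rewrite -(outm x) -sum1dep_card big_mkcond.
have -> : \sum_(y in neighbors e S) m = \sum_(y in neighbors e S) \sum_x e x y.
  by apply: eq_bigr => y _; rewrite -(inm y) -sum1dep_card big_mkcond.
rewrite [leqRHS]big_mkcond /=; apply: leq_sum => y _.
case: ifPn => yN.
  by rewrite big_mkcond /=; apply: leq_sum => x _; case: ifP.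
rewrite big1 // => x Sx; case exy: (e x y) => //.
by case/neighborsP: yN; exists x.
Qed.

(** Perfect matchings are removed one at a time, [m - j] in all. *)
Lemma biregular_subrel (T : finType) (e : rel T) m j :
  j <= m -> biregular e m -> exists2 d : rel T, subrel d e & biregular d j.
Proof.
move=> /subnKC; move: (m - j)%N => i <-; elim: i => [|i IHi] in e *.
  by rewrite addn0; exists e.
move=> e_reg; rewrite addnS in e_reg.
have [s es] := biregular_perfect_matching (ltn0Sn _) e_reg.
case: e_reg => outm inm.
have [|d de d_reg] := IHi [rel x y | e x y && (y != s x)]; last first.
  by exists d => // x y /de/andP[].
split=> [x|y].
  have := outm x; rewrite (cardsD1 (s x)) inE es => -[<-].
  by apply: eq_card => y; rewrite !inE andbC.
have := inm y; rewrite (cardsD1 ((s^-1)%g y)) inE -{2}(permKV s y) es => -[<-].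
apply: eq_card => x; rewrite !inE /= andbC; congr (_ && _).
by congr negb; apply/eqP/eqP => ->; rewrite ?permK ?permKV.
Qed.

(** * Fixed-point-free involutions and orientations *)

Lemma fpf_involution_seq (T : eqType) (s : seq T) :
  uniq s -> ~~ odd (size s) ->
  exists t : T -> T, {in s, forall x, [/\ t x \in s, t x != x & t (t x) = x]}.
Proof.
have [n] := ubnP (size s); elim: n s => // n IHn [|x [|y s]] //=.
  by exists id.
rewrite !ltnS negbK inE negb_or -!andbA => size_s /and4P[xy xs ys uniq_s] even_s.
have [t tP] := IHn s (ltnW size_s) uniq_s even_s.
exists (fun z => if z == x then y else if z == y then x else t z) => z.
rewrite !inE; have [->|zx] /= := eqVneq z x.
  by rewrite !eqxx orbT (eq_sym y x) (negPf xy).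
have [->|zy] /= := eqVneq z y; first by rewrite !eqxx.
move=> zs; have [tzs tzz ttz] := tP z zs.
have [tzx tzy]: t z != x /\ t z != y.
  by split; apply: contraTneq tzs => ->.
by rewrite (negPf tzx) (negPf tzy) tzs tzz ttz.
Qed.

Lemma fpf_involution_fibers (V T : finType) (tl : T -> V) :
  (forall v, ~~ odd #|[set a | tl a == v]|) ->
  exists t : T -> T, [/\ involutive t, forall a, t a != a & forall a, tl (t a) = tl a].
Proof.
move=> even_tl.
have fiberP v : exists t : {ffun T -> T}, [forall a, (tl a == v) ==>
    [&& tl (t a) == v, t a != a & t (t a) == a]].
  have [||t tP] := @fpf_involution_seq _ (enum [set a | tl a == v]).
  - exact: enum_uniq.
  - by rewrite -cardE.
  exists (finfun t); apply/forallP=> a; apply/implyP=> av.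
  have [|] := tP a; first by rewrite mem_enum inE.
  by rewrite mem_enum inE !ffunE => -> -> ->; rewrite eqxx.
(* The choice depends only on the fiber, so [a] and [t a] use the same pairing. *)
pose t a := xchoose (fiberP (tl a)) a.
have tP a : [/\ tl (t a) = tl a, t a != a & t (t a) = a].
  have /forallP/(_ a)/implyP/(_ (eqxx _))/and3P[/eqP tl_ta ta /eqP tta] :=
    xchooseP (fiberP (tl a)).
  by split=> //; rewrite {1}/t tl_ta.
by exists t; split=> a; have [] := tP a.
Qed.

(* The dihedral group generated by two involutions acts on [T]; the orbits of
   the rotation [t \o r] come in pairs exchanged by [r], unless [r] or [t] has
   a fixed point. *)
Lemma fpf_involutions_orientation (T : finType) (r t : T -> T) :
  involutive r -> involutive t -> (forall a, r a != a) -> (forall a, t a != a) ->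
  exists o : pred T, (forall a, o (r a) = ~~ o a) /\ (forall a, o (t a) = ~~ o a).
Proof.
move=> rK tK r_fpf t_fpf.
have [phi phiE] : exists phi : {perm T}, forall a, phi a = t (r a).
  by exists (perm (inv_inj rK) * perm (inv_inj tK))%g => a; rewrite permM !permE.
have r_iter i a : (phi ^+ i)%g (r ((phi ^+ i)%g a)) = r a.
  elim: i a => [|i IHi] a; first by rewrite !expg0 !perm1.
  by rewrite {1}expgS expgSr !permM !phiE rK tK IHi.
(* If [r a] were [phi ^+ i] applied to [a], then halfway along, [r] (for even [i]) or [t] (for odd
   [i]) would have a fixed point. *)
have r_orbit a : porbit phi (r a) != porbit phi a.
  rewrite eq_porbit_mem; apply/negP=> /porbitP[i].
  rewrite -(odd_double_half i); set j := i./2 => raE.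
  pose b := (phi ^+ j)%g a.
  case: (odd i) raE => raE; last first.
    have /eqP[] := r_fpf b; apply: (@perm_inj _ (phi ^+ j)%g).
    by rewrite r_iter raE add0n -addnn expgD permM.
  have /eqP[] := t_fpf (phi b); rewrite phiE tK -phiE.
  apply: (@perm_inj _ (phi ^+ j)%g).
  by rewrite r_iter raE /b -!permM -expgS -expgD add1n -addnn addnS.
(* Numbering the orbits selects one from each pair exchanged by [r]. *)
pose idx a := enum_rank (porbit phi a).
have idxN a : idx (r a) < idx a = ~~ (idx a < idx (r a)).
  have : idx (r a) != idx a :> nat.
    by apply: contraNneq (r_orbit a) => /ord_inj/enum_rank_inj ->.
  lia.
exists (fun a => idx a < idx (r a)); split=> a; first by rewrite rK idxN.
have -> : idx (t a) = idx (r a).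
   congr enum_rank; rewrite -{1}(rK a) -phiE; exact: (porbit_perm phi 1).
have -> : idx (r (t a)) = idx a; last exact: idxN.
congr enum_rank; rewrite -[X in _ = porbit phi X](tK a) -{2}(rK (t a)) -phiE.
by rewrite (porbit_perm phi 1).
Qed.

(** * Alternating colorings along an Eulerian circuit *)

Lemma even_orbit_coloring (T : finType) (s : {perm T}) x :
  ~~ odd #|porbit s x| ->
  exists c : pred T, {in porbit s x, forall a, c (s a) = ~~ c a}.
Proof.
set N := #|_| => evenN; exists (fun a => odd (index a (traject s x N))) => a.
rewrite porbit_traject -/N => /trajectP[i ltiN ->].
have uniqT := uniq_traject_porbit s x; rewrite -/N in uniqT.
have idx j : j < N -> index (iter j s x) (traject s x N) = j.
  by move=> ltj; rewrite -(nth_traject s ltj) index_uniq ?size_traject.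
rewrite -iterS (idx i) //; have [ltN|geN] := ltnP i.+1 N; first by rewrite idx.
have iN : i.+1 = N by apply/eqP; rewrite eqn_leq ltiN.
(* The last element returns to [x], of index 0; evenness of the orbit makes the parities differ
   there too. *)
rewrite iN iter_porbit (idx 0) /=; last by rewrite -iN.
by move: evenN; rewrite -iN /= negbK => ->.
Qed.

(** Here [T] consists of darts, [tl] gives the tail and [r] reverses. Edges are colored alternately
    along an Eulerian circuit, so each passage through a vertex uses both colors; [4 %| #|T|] makes
    the number of edges even. *)
Lemma balanced_dart_coloring (V T : finType) (tl : T -> V) (r : T -> T) :
    involutive r -> (forall a, r a != a) ->
    (forall v, ~~ odd #|[set a | tl a == v]|) ->
    (forall u v, connect [rel x y | [exists a, (tl a == x) && (tl (r a) == y)]] u v) ->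
    4 %| #|T| ->
  exists c : pred T, (forall a, c (r a) = c a) /\
    forall v, #|[set a | (tl a == v) && c a]| = #|[set a | (tl a == v) && ~~ c a]|.
Proof.
move=> rK r_fpf even_tl conn dvd4.
have [t [tK t_fpf tl_t]] := fpf_involution_fibers even_tl.
have [o [or ot]] := fpf_involutions_orientation rK tK r_fpf t_fpf.
pose succ (s : {perm T}) := [forall a, (tl (s a) == tl (r a)) && (o (s a) == o a)].
have succ0 : succ (perm (inv_inj rK) * perm (inv_inj tK))%g.
  by apply/forallP=> a; rewrite permM !permE tl_t ot or negbK !eqxx.
have [s succ_s min_s] := arg_minnP (fun s => #|porbits s|) succ0.
have tl_s a : tl (s a) = tl (r a) by have /forallP/(_ a)/andP[/eqP] := succ_s.
have o_s a : o (s a) = o a by have /forallP/(_ a)/andP[_ /eqP] := succ_s.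
(* Otherwise the transposition of [a] and [b] would join two cycles while preserving [succ], against
   minimality. *)
have merged a b : tl (r a) = tl (r b) -> o a = o b -> a \in porbit s b.
  move=> hd_ab o_ab; apply: contraT => a_b.
  have : succ (tperm a b * s)%g.
    apply/forallP=> c; rewrite permM tl_s o_s.
    by case: tpermP => [->|->|_ _]; rewrite ?hd_ab ?o_ab !eqxx.
  move/min_s; have /= := porbits_mul_tperm s a b.
  by rewrite a_b; case: (a != b); lia.
have [x0 ox0|o0] := pickP o; last first.
  have T0 (a : T) : False by have := o0 (r a); rewrite or o0.
  by exists xpred0; split=> // v; apply: eq_card => a; case: (T0 a).
have o_sV a : o ((s^-1)%g a) = o a by rewrite -[in RHS](permKV s a) o_s.
have single a : o a -> a \in porbit s x0.
  (* The property spreads from [u] to [w] along a path: whichever way the edge [d] is oriented, the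
     orbit contains a positive dart with head [w]. *)
  pose orbit_at v := forall a, o a -> tl (r a) = v -> a \in porbit s x0.
  suff orbit_all v : orbit_at v by move=> oa; apply: (orbit_all (tl (r a))).
  have orbit_x0 : orbit_at (tl (r x0)).
    by move=> b ob hd_b; apply: merged; rewrite ?ob ?ox0.
  have [p pP ->] := connectP (conn (tl (r x0)) v).
  elim: p (tl (r x0)) orbit_x0 pP => [|w p IHp] u //= orbit_u /andP[uw pathp].
  apply: (IHp w) => // b ob hd_b.
  have {uw} [d /eqP tl_d /eqP hd_d] := exists_inP uw.
  have sV_orbit e : ((s^-1)%g e \in porbit s x0) = (e \in porbit s x0).
    rewrite -!eq_porbit_mem; congr (_ == _).
    by rewrite -[in RHS](permKV s e) (porbit_perm s 1).
  have [od|/negbTE od] := boolP (o d).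
    have d_orbit : d \in porbit s x0.
      by rewrite -sV_orbit; apply: orbit_u; rewrite ?o_sV // -tl_s permKV.
    rewrite -eq_porbit_mem in d_orbit; rewrite -(eqP d_orbit).
    by apply: merged; rewrite ?ob ?od // hd_b.
  have rd_orbit : r d \in porbit s x0 by apply: orbit_u; rewrite ?or ?od ?rK.
  rewrite -sV_orbit -eq_porbit_mem in rd_orbit; rewrite -(eqP rd_orbit).
  by apply: merged; rewrite ?o_sV ?or ?ob ?od // hd_b -tl_s permKV.
have orbitE : porbit s x0 =i o.
  move=> a; apply/idP/idP => [/porbitP[i ->]|/single //].
  by rewrite unfold_in; elim: i => [|i IHi]; rewrite ?perm1 // expgSr permM o_s.
(* Reversal exchanges positive and negative darts, so the orbit has [#|T| / 2] elements. *)
have even_orbit : ~~ odd #|porbit s x0|.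
  rewrite (eq_card orbitE); have := cardC o.
  have <- : #|[set a | o a]| = #|[predC o]|.
    rewrite -(card_preimset _ (inv_inj rK)); apply: eq_card => a.
    by rewrite !inE or.
  by rewrite cardsE; lia.
have [c c_s] := even_orbit_coloring even_orbit.
pose c' a := if o a then c a else c (r a).
(* At each vertex [tau] pairs the edge by which the circuit enters with the edge by which it next
   leaves; these have opposite colors. *)
pose tau a := if o a then r ((s^-1)%g a) else s (r a).
have tau_o a : o (tau a) = ~~ o a.
  by rewrite /tau; case: ifP => oa; rewrite ?or ?o_s ?o_sV ?or oa.
have tauK : involutive tau.
  by move=> a; rewrite {1}/tau tau_o /tau; case: (o a); rewrite /= ?rK ?permKV ?permK ?rK.
have tau_tl a : tl (tau a) = tl a.
  by rewrite /tau; case: ifP => oa; rewrite ?tl_s ?rK // -tl_s permKV.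
have tau_c a : c' (tau a) = ~~ c' a.
  rewrite /c' tau_o /tau; case oa: (o a) => /=.
    by rewrite rK -[in RHS](permKV s a) c_s ?negbK // orbitE unfold_in o_sV.
  by rewrite c_s // orbitE unfold_in or oa.
exists c'; split=> [a|v]; first by rewrite /c' or; case: (o a); rewrite /= ?rK.
rewrite -[RHS](card_preimset _ (inv_inj tauK)); apply: eq_card => a.
by rewrite !inE tau_tl tau_c negbK.
Qed.

(** The darts are the ordered adjacent pairs, [#|V| * k] in number; one color class of a balanced
    coloring is the factor. *)
Lemma connected_half_factor (V : finType) (G : simple_graph V) k :
    connected_graph G -> regular G k -> ~~ odd k -> 4 %| #|V| * k ->
  exists h : rel V, [/\ subrel h G, symmetric h & forall v, #|[set u | h v u]| = k./2].
Proof.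
move=> [_ G_conn] G_reg even_k dvd4.
pose T : finType := {p : V * V | G p.1 p.2}.
have flipP (d : T) : G (val d).2 (val d).1 by rewrite adj_sym; exact: valP d.
pose r (d : T) : T := exist _ ((val d).2, (val d).1) (flipP d).
pose tl (d : T) := (val d).1.
have rK : involutive r by case=> -[u v] uv; apply: val_inj.
have r_fpf d : r d != d.
  apply/eqP=> /(congr1 val); case: d => -[u v] /= uv [vu _].
  by rewrite vu adj_irrefl in uv.
have card_out (c : pred T) v :
  #|[set d | (tl d == v) && c d]| = #|[set u | [exists d, (val d == (v, u)) && c d]]|.
  have inj_hd : {in [set d | (tl d == v) && c d] &, injective (fun d : T => (val d).2)}.
    move=> d e; rewrite !inE /tl => /andP[/eqP dv _] /andP[/eqP ev _] de.
    by apply: val_inj; rewrite [LHS]surjective_pairing [RHS]surjective_pairing dv ev de.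
  rewrite -(card_in_imset inj_hd); apply: eq_card => u; rewrite inE.
  apply/imsetP/exists_inP => [[d]|[d /eqP dE cd]].
    rewrite inE => /andP[/eqP <- cd] ->; exists d => //.
    by rewrite /tl -surjective_pairing.
  by exists d; rewrite ?inE /tl dE ?eqxx ?cd.
have card_tl v : #|[set d | tl d == v]| = k.
  rewrite -(G_reg v) -[LHS](_ : #|[set d | (tl d == v) && predT d]| = _).
    rewrite card_out; apply: eq_card => u; rewrite !inE.
    apply/existsP/idP => [[d /andP[/eqP dE _]]|vu]; first by have := valP d; rewrite dE.
    by exists (exist _ (v, u) vu : T); rewrite eqxx.
  by apply: eq_card => d; rewrite !inE andbT.
have card_T : #|T| = (#|V| * k)%N.
  rewrite -sum1_card (partition_big tl predT) //= -sum_nat_const.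
  by apply: eq_bigr => v _; rewrite sum1dep_card card_tl.
have [v|u v||c [cr c_bal]] := @balanced_dart_coloring V T tl r rK r_fpf.
- by rewrite card_tl.
- apply: connect_sub (G_conn u v) => x y xy; apply: connect1.
  by apply/existsP; exists (exist _ (x, y) xy : T); rewrite /tl !eqxx.
- by rewrite card_T.
exists (fun u v => [exists d, (val d == (u, v)) && c d]); split=> [u v|u v|v].
- by case/existsP=> d /andP[/eqP dE _]; have := valP d; rewrite dE.
- by apply/existsP/existsP=> -[d /andP[/eqP dE cd]]; exists (r d); rewrite cr cd /= dE eqxx.
rewrite -card_out; have := card_tl v.
rewrite -(cardsID [set d | c d]).
have -> : [set d | tl d == v] :&: [set d | c d] = [set d | (tl d == v) && c d].
  by apply/setP=> d; rewrite !inE.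
have -> : [set d | tl d == v] :\: [set d | c d] = [set d | (tl d == v) && ~~ c d].
  by apply/setP=> d; rewrite !inE andbC.
by rewrite -c_bal; lia.
Qed.

(** * From factors to flows *)

Local Open Scope ring_scope.

Lemma flow_of_symmetric (R : realType) (V : finType) (G : simple_graph V)
    (L : set R) (g : V -> V -> R) :
    (forall u v, g u v = g v u) -> (forall u v, L (g u v)) ->
    (forall v, \sum_(u | G v u) g v u = 1) ->
  admits_one_sum_flow G L.
Proof.
move=> gC gL g_sum.
(* The weight is read at an arbitrary ordering of the endpoints, harmless as [g] is symmetric; the
   default 0 is never reached on an edge. *)
pose F (e : {set V}) :=
  if [pick p : V * V | (e == [set p.1; p.2]%SET) && (p.1 != p.2)] is Some p
  then g p.1 p.2 else 0.
have FE u v : u != v -> F [set u; v]%SET = g u v.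
  rewrite /F => uv; case: pickP => [[x y] /= /andP[/eqP uvE xy]|/(_ (u, v))]; last first.
    by rewrite eqxx uv.
  have : x \in [set u; v]%SET by rewrite uvE set21.
  have : y \in [set u; v]%SET by rewrite uvE set22.
  by case/set2P => yE /set2P[] xE; move: xy; rewrite xE yE ?eqxx // gC.
have adj_neq u v : G u v -> u != v.
  by apply: contraTneq => ->; rewrite adj_irrefl.
exists (fun e => F (val e)); split=> [[e eP]|v] /=.
  by case/imsetP: (eP) => -[x y]; rewrite inE => /adj_neq xy ->; rewrite FE.
have inj_e : {in [set u | G v u]%SET &, injective (fun u => [set v; u]%SET)}.
  move=> x y; rewrite !inE => /adj_neq vx _ vxE.
  have : x \in [set v; y]%SET by rewrite -vxE set22.
  by case/set2P => // xv; rewrite xv eqxx in vx.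
have FE_v u : u \in [set u | G v u]%SET -> F [set v; u]%SET = g v u.
  by rewrite inE => /adj_neq; apply: FE.
transitivity (\sum_(e in [set [set v; u] | u in [set u | G v u]]%SET) F e); last first.
  by rewrite big_imset //= (eq_bigr _ FE_v) big_set g_sum.
transitivity (\sum_(e in [pred e | (e \in edge_set G) && (v \in e)]) F e).
  by rewrite -(big_sub_cond (mem (edge_set G)) (fun e => v \in e)).
apply: eq_bigl => e; rewrite !inE.
apply/andP/imsetP => [[/imsetP[[x y]]]|[u]]; rewrite inE /=; last first.
  by move=> vu ->; rewrite set21; split=> //; apply/imsetP; exists (v, u); rewrite ?inE.
move=> xy -> /set2P[->|->]; first by exists y; rewrite ?inE.
by exists x; [rewrite inE adj_sym | rewrite finset.setUC].
Qed.

Lemma odd_factor_flow (R : realType) (V : finType) (G : simple_graph V) (h : rel V) m :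
    subrel h G -> symmetric h -> (forall v, #|[set u | h v u]%SET| = m) -> odd m ->
  admits_one_sum_flow G ([set -1; 0; 1]%classic : set R).
Proof.
move=> hG h_sym h_reg odd_m.
(* For odd [m], [m./2.+1] is [(m + 1) / 2]: out- and in-degree add up to [m + 1], and subtracting 1
   on each of the [m] edges at a vertex leaves 1. *)
have [||d dh [outd ind]] := @biregular_subrel V h m m./2.+1.

- by lia.
- by split=> // y; rewrite -(h_reg y); apply: eq_card => x; rewrite !inE h_sym.
apply: (flow_of_symmetric (g := fun u v => if h u v then (d u v)%:R + (d v u)%:R - 1 else 0)).
- by move=> u v; rewrite h_sym [(d u v)%:R + _]addrC.
- move=> u v /=; case: ifP => _; last by left; right.
  case: (d u v); case: (d v u); rewrite ?addr0 ?add0r ?subrr.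
  + by right; rewrite addrK.
  + by left; right.
  + by left; right.
  + by left; left.
move=> v; rewrite -big_mkcondr /=.
have -> : \sum_(u | G v u && h v u) ((d v u)%:R + (d u v)%:R - 1 : R) =
    \sum_u (d v u)%:R + \sum_u (d u v)%:R - \sum_u (h v u)%:R.
  rewrite -big_split -sumrB big_mkcond; apply: eq_bigr => u _ /=.
  case: ifPn => [/andP[_ ->] //|].
  have [vu|vu _] := boolP (h v u); first by rewrite hG.
  have /negbTE -> : ~~ d v u by apply: contra vu; apply: dh.
  have /negbTE -> : ~~ d u v by apply: contra vu => /dh; rewrite h_sym.
  by rewrite addr0 subr0.
have sum_card (P : pred V) : \sum_u (P u)%:R = #|[set u | P u]%SET|%:R :> R.
  by rewrite -sum1dep_card natr_sum [RHS]big_mkcond; apply: eq_bigr => u _; case: (P u).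
rewrite !sum_card outd ind h_reg -natrD -[m in X in _ - X]odd_double_half odd_m.
by rewrite -addnn addSn addnS -addSn -[_.+2]addn1 -addSn natrD addrC addKr.
Qed.

Theorem theorem7 (R : realType) (k n : nat) (V : finType) (G : simple_graph V)
    (k_gt0 : (0 < k)%N) (G_conn : connected_graph G) (G_reg : regular G k)
    (G_order : #|V| = n) :
  (odd k -> admits_one_sum_flow G ([set -1; 0; 1]%classic : set R)) /\
  (k = 2 %[mod 4] -> ~~ odd n ->
     admits_one_sum_flow G ([set -1; 0; 1]%classic : set R)).
Proof.
split=> [odd_k | k_mod4 even_n].
  exact: (odd_factor_flow R (h := G)) (@adj_sym _ G) G_reg odd_k.
(* Both [n] and [k] are even, so 4 divides [n * k]; the factor has degree [k./2], which is odd. *)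
have [|| h [hG h_sym h_reg]] := connected_half_factor G_conn G_reg.
- lia.
- rewrite G_order; lia.
by apply: odd_factor_flow hG h_sym h_reg _; lia.
Qed.
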